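(* Let $n\ge 2$ and let $\Gamma_{n-1}\subset\Gamma_n$ be an inclusion of Coxeter graphs of spherical type with vertex sets $\{x_1,\dots,x_{n-1}\}$ and $\{x_1,\dots,x_n\}$ respectively. Let $R_n=\Delta(\Gamma_n,\Gamma_{n-1})\in\mathcal{M}(\Gamma_n)$ be the relative Garside element, and let $\sigma_n:\{1,\dots,n\}\to\{1,\dots,n\}$ be the bijection with $x_i\,\Delta(\Gamma_n)=\Delta(\Gamma_n)\,x_{\sigma_n(i)}$ for all $i$. Then: (a) $R_n$ is square free; (b) for $i\in\{1,\dots,n\}$, $x_i\mid_L R_n$ if and only if $i=n$; (c) there is a bijection $\sigma:\{1,\dots,n-1\}\to\{1,\dots,n\}\setminus\{\sigma_n(n)\}$ such that $x_iR_n=R_nx_{\sigma(i)}$ for all $i\in\{1,\dots,n-1\}$; (d) for $j\in\{1,\dots,n\}$, $x_j\mid_R R_n$ if and only if $j=\sigma_n(n)$.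
   Context: A Coxeter matrix over a set $S$ is $M=(m_{st})_{s,t\in S}$ with $m_{ss}=1$ and $m_{st}=m_{ts}\in\{2,3,4,\dots,\infty\}$ for $s\ne t$; its Coxeter graph $\Gamma$ has vertex set $S$, an edge between $s,t$ when $m_{st}\ge3$, labelled by $m_{st}$ when $m_{st}\ge4$. The Artin monoid $\mathcal{M}(\Gamma)$ is the monoid generated by $S$ with relations $\underbrace{sts\cdots}_{m_{st}}=\underbrace{tst\cdots}_{m_{st}}$ for all $s\ne t$ with $m_{st}\neq\infty$. $\Gamma$ is of spherical type if the Coxeter group (obtained by adding the relations $s^2=1$) is finite. An inclusion $\Gamma_{n-1}\subset\Gamma_n$ means that $\Gamma_{n-1}$ is the full labelled subgraph of $\Gamma_n$ on the vertices $x_1,\dots,x_{n-1}$ (so $\Gamma_n$ has one new vertex $x_n$); $\mathcal{M}(\Gamma_{n-1})$ is regarded as the submonoid of $\mathcal{M}(\Gamma_n)$ generated by $x_1,\dots,x_{n-1}$. Divisibility in a monoid: $\alpha\mid\beta$ means $\beta=\lambda\alpha\rho$ for some $\lambda,\rho$; $\alpha\mid_L\beta$ means $\beta=\alpha\rho$ for some $\rho$; $\alpha\mid_R\beta$ means $\beta=\lambda\alpha$ for some $\lambda$. An element $\omega$ is square free if there is no generator $x_i$ with $x_i^2\mid\omega$. For $\Gamma$ of spherical type, the Garside element $\Delta(\Gamma)\in\mathcal{M}(\Gamma)$ is the unique element such that $s\mid_L\Delta(\Gamma)$ for every generator $s$, and whenever $s\mid_L\omega$ for all generators $s$ then $\Delta(\Gamma)\mid_L\omega$.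 One has $\Delta(\Gamma_{n-1})\mid_L\Delta(\Gamma_n)$, and the relative Garside element $R_n=\Delta(\Gamma_n,\Gamma_{n-1})$ is the (unique, by cancellativity) element with $\Delta(\Gamma_n)=\Delta(\Gamma_{n-1})\,R_n$. It is a known fact that conjugation by the Garside element permutes the generators, which gives the bijection $\sigma_n$. *)

(* Defs.v *)
From HB Require Import structures.
From Stdlib Require Import Relations.
From mathcomp Require Import all_boot perm.
From mathcomp Require Import boolp classical_sets functions cardinality.
Set Implicit Arguments.
Unset Strict Implicit.
Unset Printing Implicit Defensive.

Local Open Scope group_scope.
Local Open Scope classical_set_scope.
Local Open Scope quotient_scope.

Section Presentation.
Variables (S : choiceType) (r : seq S -> seq S -> Prop).
Implicit Types u v w : seq S.

Inductive rewrite_step : seq S -> seq S -> Prop :=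
  RewriteStep a b u v : r u v -> rewrite_step (a ++ u ++ b) (a ++ v ++ b).

Definition congruent : seq S -> seq S -> Prop :=
  clos_refl_sym_trans (seq S) rewrite_step.

(* The quotient construction needs a boolean relation. *)
Definition congruentb u v : bool := `[< congruent u v >].

Lemma congruentb_refl : reflexive congruentb.
Proof. by move=> u; apply/asboolP; apply: rst_refl. Qed.

Lemma congruentb_sym : symmetric congruentb.
Proof. by move=> u v; apply/asboolP/asboolP; apply: rst_sym. Qed.

Lemma congruentb_trans : transitive congruentb.
Proof.
by move=> v u w /asboolP uv /asboolP vw; apply/asboolP; apply: rst_trans uv vw.
Qed.

Canonical congruent_equiv :=
  EquivRel congruentb congruentb_refl congruentb_sym congruentb_trans.

Definition presented := {eq_quot congruent_equiv}.
HB.instance Definition _ := Choice.on presented.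
HB.instance Definition _ := Quotient.on presented.

Definition pres_class w : presented := \pi_presented w.

Lemma pres_classP u v : pres_class u = pres_class v <-> congruent u v.
Proof. by split=> [/eqmodP/asboolP//|uv]; apply/eqmodP/asboolP. Qed.

Lemma pres_classK (x : presented) : pres_class (repr x) = x.
Proof. exact: reprK. Qed.

Lemma congruent_cat u u' v v' :
  congruent u u' -> congruent v v' -> congruent (u ++ v) (u' ++ v').
Proof.
move=> uu' vv'; apply: (@rst_trans _ _ _ (u' ++ v)).
  elim: uu' => [{u u'}_ _ [a b u u' uu']|w|w w' _|w1 w2 w3 _ IH1 _] /=.
  - by rewrite -!catA; apply/rst_step/RewriteStep.
  - exact: rst_refl.
  - exact: rst_sym.
  - exact: rst_trans.
elim: vv' => [{v v'}_ _ [a b v v' vv']|w|w w' _|w1 w2 w3 _ IH1 _] /=.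
- by rewrite !(catA u'); apply/rst_step/RewriteStep.
- exact: rst_refl.
- exact: rst_sym.
- exact: rst_trans.
Qed.

Definition pres_one : presented := pres_class [::].

Definition pres_mul (x y : presented) : presented :=
  pres_class (repr x ++ repr y).

Lemma pres_mulE u v :
  pres_mul (pres_class u) (pres_class v) = pres_class (u ++ v).
Proof.
by apply/pres_classP/congruent_cat; apply/pres_classP; rewrite pres_classK.
Qed.

Lemma pres_mulA : associative pres_mul.
Proof.
move=> x y z; rewrite -(pres_classK x) -(pres_classK y) -(pres_classK z).
by rewrite !pres_mulE catA.
Qed.

Lemma pres_mul1 : left_id pres_one pres_mul.
Proof. by move=> x; rewrite -(pres_classK x) pres_mulE. Qed.

Lemma pres_mulr1 : right_id pres_one pres_mul.
Proof. by move=> x; rewrite -(pres_classK x) pres_mulE cats0. Qed.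

HB.instance Definition _ :=
  isMonoid.Build presented pres_mulA pres_mul1 pres_mulr1.

Definition pres_gen (s : S) : presented := pres_class [:: s].

Lemma pres_class_cat u v : pres_class (u ++ v) = pres_class u * pres_class v.
Proof. exact/esym/pres_mulE. Qed.

Lemma pres_class_prod w : pres_class w = \prod_(s <- w) pres_gen s.
Proof.
elim: w => [|s w IHw]; first by rewrite big_nil.
by rewrite big_cons -IHw -pres_class_cat.
Qed.

End Presentation.

Section PresentationMap.
Variables (S T : choiceType).
Variables (r : seq S -> seq S -> Prop) (r' : seq T -> seq T -> Prop).
Variable f : S -> T.

(* The morphism sending each generator s to the generator f s.  It goes through
   a representative, hence is only meaningful under the hypothesis rf below. *)
Definition pres_map (x : presented r) : presented r' :=
  pres_class r' (map f (repr x)).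

Hypothesis rf : forall u v, r u v -> r' (map f u) (map f v).

Lemma pres_mapE w : pres_map (pres_class r w) = pres_class r' (map f w).
Proof.
apply/pres_classP.
have: congruent r (repr (pres_class r w)) w.
  by apply/pres_classP; rewrite pres_classK.
move: (repr _) => w'; elim=> {w w'} [_ _ [a b u v uv]|u|u v _|u v v' _ IH1 _ IH2].
- by rewrite !map_cat; apply/rst_step/RewriteStep/rf.
- exact: rst_refl.
- exact: rst_sym.
- exact: rst_trans IH1 IH2.
Qed.

Lemma pres_map_gen s : pres_map (pres_gen r s) = pres_gen r' (f s).
Proof. exact: pres_mapE. Qed.

Lemma pres_map_morphism : monoid_morphism pres_map.
Proof.
split=> [|x y]; first exact: pres_mapE.
rewrite -(pres_classK x) -(pres_classK y) -pres_class_cat !pres_mapE.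
by rewrite map_cat pres_class_cat.
Qed.

End PresentationMap.

Section Divisibility.
Variable M : monoidType.
Implicit Types a b : M.

Definition divides a b : Prop := exists l r : M, b = l * a * r.
Definition ldivides a b : Prop := exists r : M, b = a * r.
Definition rdivides a b : Prop := exists l : M, b = l * a.

End Divisibility.

(* A Coxeter graph is given by its Coxeter matrix; None encodes infinity. *)
Record coxeter_graph (S : choiceType) := CoxeterGraph {
  cox :> S -> S -> option nat;
  cox_diag : forall s, cox s s = Some 1%N;
  cox_sym : forall s t, cox s t = cox t s;
  cox_ge2 : forall s t m, s != t -> cox s t = Some m -> 1 < m
}.

(* The word s t s ... of length m. *)
Definition alternating (S : Type) (m : nat) (s t : S) : seq S :=
  mkseq (fun i => if odd i then t else s) m.

Section Artin.
Variables (S : choiceType) (G : coxeter_graph S).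

Inductive braid_rel : seq S -> seq S -> Prop :=
  BraidRel s t m : s != t -> G s t = Some m ->
    braid_rel (alternating m s t) (alternating m t s).

Definition artin_monoid := presented braid_rel.
HB.instance Definition _ := Monoid.on artin_monoid.

Definition artin_gen : S -> artin_monoid := pres_gen braid_rel.

Inductive coxeter_rel : seq S -> seq S -> Prop :=
| CoxeterBraid u v : braid_rel u v -> coxeter_rel u v
| CoxeterSquare s : coxeter_rel [:: s; s] [::].

Definition coxeter_group := presented coxeter_rel.
HB.instance Definition _ := Monoid.on coxeter_group.

(* The relations s^2 = 1 make the presented monoid a group, so that it is also
   the group with the same presentation. *)
Definition coxeter_inv (x : coxeter_group) : coxeter_group :=
  pres_class coxeter_rel (rev (repr x)).

HB.instance Definition _ := hasInv.Build coxeter_group coxeter_inv.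

Lemma coxeter_class_revl w :
  pres_class coxeter_rel (rev w ++ w) = 1 :> coxeter_group.
Proof.
elim: w => // s w <-; apply/pres_classP.
rewrite rev_cons cat_rcons.
exact/rst_step/(RewriteStep (rev w) w (CoxeterSquare s)).
Qed.

Lemma coxeter_mulVg : left_inverse 1 coxeter_inv (@mul coxeter_group).
Proof.
by move=> x; rewrite -{2}(pres_classK x) -[LHS]pres_class_cat coxeter_class_revl.
Qed.

Lemma coxeter_mulgV : right_inverse 1 coxeter_inv (@mul coxeter_group).
Proof.
move=> x; rewrite -{1}(pres_classK x) -[LHS]pres_class_cat.
by rewrite -{1}(revK (repr x)) coxeter_class_revl.
Qed.

HB.instance Definition _ :=
  Monoid_isGroup.Build coxeter_group coxeter_mulVg coxeter_mulgV.

Definition spherical : Prop := finite_set [set: coxeter_group].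

Definition square_free (w : artin_monoid) : Prop :=
  ~ exists s : S, divides (artin_gen s ^+ 2) w.

Definition is_garside (D : artin_monoid) : Prop :=
  (forall s, ldivides (artin_gen s) D) /\
  (forall w, (forall s, ldivides (artin_gen s) w) -> ldivides D w).

End Artin.

Section Inclusion.
Variables (n : nat) (G' : coxeter_graph 'I_n) (G : coxeter_graph 'I_n.+1).

(* lift ord_max is the inclusion of 'I_n in 'I_n.+1 preserving values; the new
   vertex is ord_max. *)
Definition full_subgraph : Prop :=
  forall i j : 'I_n, G' i j = G (lift ord_max i) (lift ord_max j).

Definition artin_incl : artin_monoid G' -> artin_monoid G :=
  pres_map (braid_rel G) (lift ord_max).

Hypothesis sub : full_subgraph.

Lemma braid_rel_lift u v : braid_rel G' u v ->
  braid_rel G (map (lift ord_max) u) (map (lift ord_max) v).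
Proof.
case=> s t m st Gst; rewrite /alternating /mkseq -!map_comp.
have -> (a b : 'I_n) : map (lift ord_max \o (fun i => if odd i then a else b))
    (iota 0 m) = alternating m (lift ord_max b) (lift ord_max a).
  by apply: eq_map => i /=; case: ifP.
have -> (a b : 'I_n) : map (lift ord_max \o (fun i => if odd i then a else b))
    (iota 0 m) = alternating m (lift ord_max b) (lift ord_max a).
  by apply: eq_map => i /=; case: ifP.
apply: BraidRel; last by rewrite -sub.
by rewrite (inj_eq lift_inj).
Qed.

Lemma artin_incl_gen i :
  artin_incl (artin_gen G' i) = artin_gen G (lift ord_max i).
Proof. exact: (pres_map_gen braid_rel_lift). Qed.

Lemma artin_incl_morphism : monoid_morphism artin_incl.
Proof. exact: (pres_map_morphism braid_rel_lift). Qed.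

End Inclusion.

(* Main.v *)
Require Import Defs.
From Stdlib Require Import Relations.
From mathcomp Require Import all_boot all_order all_algebra all_field perm ring.
From mathcomp Require Import boolp classical_sets functions cardinality.

(** Everything takes place among reduced words of the Coxeter group W of G, that
    is, shortest words in their class.  Two facts about Coxeter groups carry the
    proof.  The exchange property ([reduced_exchange]): if a reduced word u does
    not stay reduced when s is put in front of it, then u equals in W a reduced
    word beginning with s.
    Matsumoto's theorem ([matsumoto]): two reduced words of the same element of W
    are related by braid moves, hence define the same element of the Artin
    monoid.  The theorem thus lets equations in W be lifted to the Artin monoid
    as soon as both sides are reduced, and this replaces every appeal to
    cancellativity of the monoid.

    When W is finite it has a reduced word of maximal length, which begins with
    any prescribed generator up to braid moves.  The Garside element D divides
    the class of such a word, so all words of D are reduced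
    ([garside_reduced]); in particular D contains no square.  Every reduced word
    is a prefix of D ([reduced_prefix_of_longest]).  Writing D = s e, the word e
    is one letter too short, so D = e t for some generator t; then s D = s e t =
    D t, and s -> t is a permutation of the generators, each of which therefore
    divides D on the right ([garside_conj_bij]).

    Now let D = D' R, where D' is the Garside element of the smaller graph.
    Being a factor of D, R is square free.  For an old generator x, D' = e x, so
    that x cannot divide R on the left without producing x^2 in D; and R <> 1
    since the new generator does not occur in D'.  This gives (b).  For (c),
    k D' = D' x and k D = D j give D' x R = D' R j; in W the factor D' cancels,
    and x R is reduced because e x R = D, so Matsumoto's theorem gives
    x R = R j.  The generators j so obtained are all but the image of the new
    one; such a j does not divide R on the right, since R = r j would give
    D = e x R = e R j = e r j^2.  As R <> 1, this proves (d).

    The exchange property comes from Bourbaki's cocycle, the parity of the number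
    of times a reflection occurs among the p s p^-1 attached to the factorizations
    p s q of a word ([inversion]).  Matsumoto's theorem needs
    moreover that the order of a product s t in W is not a proper divisor of m_st,
    which is read off a complex reflection representation
    ([coxeter_class_alternating_inj]). *)

Set Implicit Arguments.
Unset Strict Implicit.
Unset Printing Implicit Defensive.

Local Open Scope group_scope.
Local Open Scope classical_set_scope.

(** * Words and congruences *)

(** To be applied with F a length, a support, an image in W, an operator...:
    invariants of words are checked on a single relation in context. *)
Lemma congruent_invariant (S : choiceType) (r : seq S -> seq S -> Prop)
    (A : Type) (F : seq S -> A) :
  (forall a b u v, r u v -> F (a ++ u ++ b) = F (a ++ v ++ b)) ->
  forall u v, congruent r u v -> F u = F v.
Proof.
move=> Fr u v; elim=> {u v} [_ _ [a b u v /Fr-> //]|//|u v _ -> //|].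
by move=> u v w _ -> _ ->.
Qed.

Section AlternatingWords.
Variable S : choiceType.
Implicit Types (s t : S).

Lemma size_alternating k s t : size (alternating k s t) = k.
Proof. by rewrite size_mkseq. Qed.

Lemma alternatingS k s t : alternating k.+1 s t = s :: alternating k t s.
Proof.
rewrite /alternating /mkseq /= -[in LHS](addn0 1%N) iotaDl -map_comp.
by congr (_ :: _); apply: eq_map => i /=; case: (odd i).
Qed.

Lemma take_alternating j k s t : j <= k ->
  take j (alternating k s t) = alternating j s t.
Proof.
by move=> jk; rewrite /alternating /mkseq -map_take take_iota (minn_idPl jk).
Qed.

Lemma mem_alternating x k s t : (1 < k)%N ->
  (x \in alternating k s t) = (x == s) || (x == t).
Proof.
case: k => [|[|k]] // _; rewrite !alternatingS !inE.
elim: k s t => [|k IHk] s t; first by rewrite in_nil orbF.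
by rewrite alternatingS in_cons IHk orbCA orbb orbC.
Qed.

Definition dihedral_word k s t : seq S := flatten (nseq k [:: s; t]).

Lemma dihedral_word_shift k s t :
  dihedral_word k.+1 s t = s :: rcons (dihedral_word k t s) t.
Proof.
by elim: k => // k IHk; rewrite -[LHS]/[:: s, t & dihedral_word k.+1 s t] IHk.
Qed.

(** Since generators are involutions, this turns the equality of two alternating
    words into the triviality of (s t)^k, here and in the representation. *)
Lemma alternating_cat_rev k s t :
  alternating k s t ++ rev (alternating k t s) = dihedral_word k s t.
Proof.
elim: k s t => // k IHk s t.
by rewrite !alternatingS rev_cons dihedral_word_shift -rcons_cat -IHk.
Qed.

End AlternatingWords.

(** * The inversion cocycle and the exchange property *)

Section CoxeterWords.
Variables (S : choiceType) (G : coxeter_graph S).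
Implicit Types (s t : S) (u v w p q : seq S).

Local Notation W := (coxeter_group G).

Definition coxeter_class u : W := pres_class (coxeter_rel G) u.
Local Notation cls := coxeter_class.

Lemma coxeter_classP u v : cls u = cls v <-> congruent (coxeter_rel G) u v.
Proof. exact: pres_classP. Qed.

Lemma coxeter_class_repr (x : W) : cls (repr x) = x.
Proof. exact: pres_classK. Qed.

Lemma coxeter_class_nil : cls [::] = 1.
Proof. by []. Qed.

Lemma coxeter_class_cat u v : cls (u ++ v) = cls u * cls v.
Proof. exact: pres_class_cat. Qed.

Lemma coxeter_class_cons s u : cls (s :: u) = cls [:: s] * cls u.
Proof. exact: (coxeter_class_cat [:: s]). Qed.

Lemma coxeter_class_rev u : cls (rev u) = (cls u)^-1.
Proof.
apply: (mulIg (cls u)); rewrite mulVg -coxeter_class_cat.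
exact: (coxeter_class_revl G u).
Qed.

Lemma coxeter_genV s : (cls [:: s])^-1 = cls [:: s].
Proof. by rewrite -coxeter_class_rev. Qed.

Lemma coxeter_genK s x : cls [:: s] * (cls [:: s] * x) = x.
Proof. by rewrite -{1}coxeter_genV mulKg. Qed.

Lemma coxeter_gen2 s : cls [:: s] * cls [:: s] = 1.
Proof. by rewrite -{1}coxeter_genV mulVg. Qed.

Lemma coxeter_class_alternating_eq k s t :
  cls (alternating k s t) = cls (alternating k t s) <->
  (cls [:: s] * cls [:: t]) ^+ k = 1.
Proof.
suff -> : (cls [:: s] * cls [:: t]) ^+ k =
    cls (alternating k s t) * (cls (alternating k t s))^-1.
  by split=> [->|/divg1_eq]; first exact: mulgV.
rewrite -coxeter_class_rev -[RHS]coxeter_class_cat alternating_cat_rev.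
elim: k => // k IHk; rewrite expgS IHk.
rewrite -[dihedral_word k.+1 s t]/(_ ++ _) coxeter_class_cat.
by rewrite (coxeter_class_cons s [:: t]).
Qed.

Lemma braid_rel_class u v : braid_rel G u v -> cls u = cls v.
Proof.
move=> uv; apply/coxeter_classP; apply: rst_step.
by have := RewriteStep [::] [::] (CoxeterBraid uv); rewrite !cats0.
Qed.

(** The parity of the number of factorizations u = p s q such that
    x = p s p^-1.  For reduced u such an x is an inversion of u. *)
Fixpoint inversion u (x : W) : bool :=
  if u is s :: u' then
    (x == cls [:: s]) (+) inversion u' (cls [:: s] * x * cls [:: s])
  else false.

Lemma inversion_cat u v x :
  inversion (u ++ v) x = inversion u x (+) inversion v ((cls u)^-1 * x * cls u).
Proof.
elim: u x => [|s u IHu] x /=; first by rewrite coxeter_class_nil invg1 mul1g mulg1.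
rewrite IHu addbA; congr (_ (+) inversion v _).
by rewrite (coxeter_class_cons s u) invgM coxeter_genV !mulgA.
Qed.

Lemma inversion_infix a b u v :
    inversion u =1 inversion v -> cls u = cls v ->
  inversion (a ++ u ++ b) =1 inversion (a ++ v ++ b).
Proof. by move=> uv cuv x; rewrite !inversion_cat uv cuv. Qed.

Lemma inversion_alternating k s t x :
  inversion (alternating k s t) x =
  \big[addb/false]_(j < k) (x == (cls [:: s] * cls [:: t]) ^+ j * cls [:: s]).
Proof.
elim: k s t x => [|k IHk] s t x; first by rewrite big_ord0.
rewrite alternatingS big_ord_recl /= expg0 mul1g IHk; congr (_ (+) _).
apply: eq_bigr => j _; rewrite /bump /= add1n.
have -> : (cls [:: s] * cls [:: t]) ^+ j.+1 * cls [:: s] =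
    cls [:: s] * ((cls [:: t] * cls [:: s]) ^+ j * cls [:: t]) * cls [:: s].
  elim: (nat_of_ord j) => [|i IHi]; first by rewrite expg1 expg0 mul1g.
  by rewrite expgS -!mulgA (mulgA _ _ (cls [:: s])) IHi expgS !mulgA.
apply/eqP/eqP => [<-|->]; first by rewrite -!mulgA coxeter_gen2 mulg1 coxeter_genK.
by rewrite -!mulgA coxeter_gen2 mulg1 coxeter_genK.
Qed.

(** The reflections attached to the alternating word of length m on s, t are the
    (s t)^j s; since (s t)^m = 1, exchanging s and t lists them backwards. *)
Lemma inversion_braid u v : braid_rel G u v -> inversion u =1 inversion v.
Proof.
move=> uv; have := braid_rel_class uv; case: uv => s t m _ _.
move/coxeter_class_alternating_eq => stm x; rewrite !inversion_alternating.
rewrite (reindex_inj rev_ord_inj) /=; apply: eq_bigr => j _.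
congr (_ == _); apply: divg1_eq.
rewrite invgM coxeter_genV -expVgn invgM !coxeter_genV.
rewrite mulgA -(mulgA _ _ (cls [:: t])) -expgSr -expgnDr.
by rewrite addSnnS subnK.
Qed.

(** Relations of W leave the list of attached reflections unchanged up to order and
    up to pairs of equal terms, so [inversion] descends from words to W. *)
Lemma inversion_class u v : cls u = cls v -> inversion u =1 inversion v.
Proof.
move/coxeter_classP => uv x; move: u v uv; apply: congruent_invariant.
move=> a b u v uv; apply: inversion_infix.
  case: uv => [u' v' /inversion_braid //|s y] /=.
  rewrite addbF.
  have -> : (cls [:: s] * y * cls [:: s] == cls [:: s]) = (y == cls [:: s]).
    apply/eqP/eqP => [|->]; last by rewrite coxeter_gen2 mul1g.
    by move/(congr1 (fun z => cls [:: s] * (z * cls [:: s]))); rewrite -!mulgA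
      coxeter_gen2 mulg1 coxeter_genK mulg1.
  by rewrite addbb.
apply/coxeter_classP; apply: rst_step.
by have := RewriteStep [::] [::] uv; rewrite !cats0.
Qed.

Lemma inversion_split u x : inversion u x ->
  exists p s q, u = p ++ s :: q /\ x * cls p = cls (rcons p s).
Proof.
elim: u x => //= s u IHu x.
have [-> _|_ /IHu[p [t [q [-> pt]]]]] := eqVneq x (cls [:: s]).
  by exists [::], s, u; rewrite mulg1.
exists (s :: p), t, q; split=> //.
rewrite rcons_cons (coxeter_class_cons s p) (coxeter_class_cons s (rcons p t)) -pt.
by rewrite -!mulgA coxeter_genK.
Qed.

(** * Reduced words *)

Definition reduced u := forall v, cls v = cls u -> (size u <= size v)%N.

Lemma odd_size_class u v : cls u = cls v -> odd (size u) = odd (size v).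
Proof.
move/coxeter_classP.
apply: (congruent_invariant (F := fun w => odd (size w))) => a b {u v} _ _ [].
  by move=> _ _ [s t m _ _]; rewrite !size_cat !size_alternating.
by move=> s; rewrite !size_cat !oddD.
Qed.

Lemma exists_reduced u : exists2 v, reduced v & cls v = cls u.
Proof.
pose P k := `[< exists2 v, cls v = cls u & size v = k >].
have exP : exists k, P k by exists (size u); apply/asboolP; exists u.
case: (ex_minnP exP) => k /asboolP[v vu vk] kmin; exists v => // w wv.
by rewrite vk; apply/kmin/asboolP; exists w => //; rewrite wv.
Qed.

Lemma reduced_class u v :
  reduced u -> cls v = cls u -> size v = size u -> reduced v.
Proof. by move=> red_u vu svu w wv; rewrite svu; apply: red_u; rewrite wv. Qed.

Lemma reduced_catl u v : reduced (u ++ v) -> reduced u.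
Proof.
move=> red_uv w wu; have := red_uv (w ++ v); rewrite !coxeter_class_cat wu.
by move/(_ erefl); rewrite !size_cat leq_add2r.
Qed.

Lemma reduced_catr u v : reduced (u ++ v) -> reduced v.
Proof.
move=> red_uv w wv; have := red_uv (u ++ w); rewrite !coxeter_class_cat wv.
by move/(_ erefl); rewrite !size_cat leq_add2l.
Qed.

Lemma not_reduced_square p s q : ~ reduced (p ++ [:: s; s] ++ q).
Proof.
move=> red; have := red (p ++ q); rewrite !coxeter_class_cat.
rewrite (coxeter_class_cons s [:: s]) coxeter_gen2 mul1g => /(_ erefl).
by rewrite !size_cat leq_add2l /= ltnNge leqnSn.
Qed.

(** For u = p t q the last equation gives s u = p q in W: multiplying by an
    inversion deletes a letter. *)
Lemma inversion_deletion u s : inversion u (cls [:: s]) ->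
  exists p t q, u = p ++ t :: q /\ cls (s :: p) = cls (rcons p t).
Proof.
case/inversion_split=> p [t [q [-> pt]]]; exists p, t, q.
by rewrite coxeter_class_cons.
Qed.

Lemma deletion_class s p t q : cls (s :: p) = cls (rcons p t) ->
  cls (s :: p ++ q) = cls (p ++ t :: q).
Proof.
by move=> spt; rewrite -cat_cons -cat_rcons !coxeter_class_cat spt.
Qed.

(** The first letter of s u contributes s once; if u contributed s again, a letter
    of u could be deleted and s u would not be reduced. *)
Lemma inversion_reduced_head s u :
  reduced (s :: u) -> inversion (s :: u) (cls [:: s]).
Proof.
move=> red /=; rewrite eqxx coxeter_gen2 mul1g addTb; apply/negP.
case/inversion_deletion=> p [t [q [def_u /deletion_class spt]]].
have := red (p ++ q); rewrite (coxeter_class_cons s u) def_u -spt.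
rewrite (coxeter_class_cons s (p ++ q)) coxeter_genK => /(_ erefl).
by rewrite /= !size_cat /= addnS ltnNge leqnSn.
Qed.

(** A reduced word v of s u is shorter than s u, hence by parity shorter than u, so
    that s v is another reduced word of u, and it begins with s. *)
Lemma inversion_not_reduced s u : reduced u -> ~ reduced (s :: u) ->
  inversion u (cls [:: s]).
Proof.
move=> red_u nred; have [v red_v vsu] := exists_reduced (s :: u).
have suv : cls (s :: v) = cls u.
  by rewrite (coxeter_class_cons s v) vsu (coxeter_class_cons s u) coxeter_genK.
have : (size v < size (s :: u))%N.
  rewrite ltnNge; apply/negP => le_suv; apply: nred => w wsu.
  by apply: leq_trans le_suv _; apply: red_v; rewrite wsu.
have := odd_size_class suv; rewrite /= ltnS leq_eqVlt => odd_uv.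
case/predU1P=> [suv'|lt_vu]; first by rewrite suv' in odd_uv; case: odd odd_uv.
rewrite -(inversion_class suv); apply: inversion_reduced_head.
by apply: (reduced_class red_u suv); apply/eqP; rewrite eqn_leq lt_vu red_u.
Qed.

(** Exchange: u gives up a letter and receives s in front. *)
Lemma reduced_exchange s u : reduced u -> inversion u (cls [:: s]) ->
  exists2 v, reduced (s :: v) & cls (s :: v) = cls u /\ size (s :: v) = size u.
Proof.
move=> red /inversion_deletion[p [t [q [def_u /deletion_class spt]]]].
have spqu : cls (s :: p ++ q) = cls u by rewrite def_u spt.
exists (p ++ q); last first.
  by split=> //; rewrite def_u /= !size_cat /= addnS.
by apply: reduced_class red spqu _; rewrite def_u /= !size_cat /= addnS.
Qed.

End CoxeterWords.

(** * The order of a product of two generators *)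

Section ReflectionRepresentation.
Import GRing.Theory Num.Theory.
Local Open Scope ring_scope.

(** The characteristic roots 1, q, q' of the recurrence are distinct m-th roots of
    unity. *)
Lemma recurrence_periodic (K : fieldType) (q q' : K) m (g : nat -> K) :
    q * q' = 1 -> q != 1 -> q != q' -> q ^+ m = 1 ->
    (forall k, g k.+3 = (1 + q + q') * (g k.+2 - g k.+1) + g k) ->
  g m = g 0%N.
Proof.
move=> qq' q1 qNq' qm rec.
have q'm : q' ^+ m = 1 by rewrite -[LHS]mul1r -qm -exprMn qq' expr1n.
(* Applying two of the three factors of the recurrence operator to g leaves a
   geometric progression whose ratio x is the third root. *)
have eigen x y z : [\/ [/\ x = 1, y = q & z = q'],
    [/\ x = q, y = 1 & z = q'] | [/\ x = q', y = 1 & z = q]] ->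
    x ^+ m = 1 -> g m.+2 - (y + z) * g m.+1 + y * z * g m =
                  g 2%N - (y + z) * g 1%N + y * z * g 0%N.
  move=> xyz xm; rewrite -[RHS]mul1r -xm; move: m {xm qm q'm} => i.
  elim: i => [|k IHk]; first by rewrite mul1r.
  rewrite exprS -[RHS]mulrA -IHk rec; have q'q : q' * q = 1 by rewrite mulrC.
  by case: xyz => -[-> -> ->]; ring: qq' q'q.
have e1 := eigen 1 q q' (Or31 _ _ (And3 erefl erefl erefl)) (expr1n _ _).
have e2 := eigen q 1 q' (Or32 _ _ (And3 erefl erefl erefl)) qm.
have e3 := eigen q' 1 q (Or33 _ _ (And3 erefl erefl erefl)) q'm.
have subC a b c d : a = b -> c = d -> (a - b) - (c - d) = 0 :> K.
  by move=> -> ->; rewrite !subrr.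
have d10 : g m.+1 = g 1%N + (g m - g 0%N).
  apply/eqP; rewrite -subr_eq0; apply/eqP.
  apply: (mulfI (x := q - q')); first by rewrite subr_eq0.
  by rewrite mulr0 -[RHS](subC _ _ _ _ e2 e3); ring.
have q'1 : q' != 1 by apply: contra_neq q1 => q'1; rewrite -qq' q'1 mulr1.
apply/eqP; rewrite -subr_eq0; apply/eqP.
apply: (mulfI (x := (1 - q) * (1 - q'))).
  by rewrite mulf_neq0 // subr_eq0 eq_sym.
by rewrite mulr0 -[RHS](subC _ _ _ _ e1 e2); ring: qq' d10.
Qed.

Section Representation.
Variables (S : choiceType) (G : coxeter_graph S).
Implicit Types (s t : S) (u v : seq S) (f : S -> algC).

(** The intended eigenvalue of s t when m_st = o.  The value 2 only has to be
    nonzero and not a root of unity. *)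
Definition dihedral_root (o : option nat) : algC :=
  if o is Some m then sval (C_prim_root_exists (ltn0Sn m.-1)) else 2%:R.

Lemma dihedral_root_prim m : (0 < m)%N ->
  m.-primitive_root (dihedral_root (Some m)).
Proof. by case: m => // m _; exact: (svalP (C_prim_root_exists (ltn0Sn m))). Qed.

(** For q = exp (2 i pi / m) this is 2 |cos (pi / m)|, up to sign twice the
    classical bilinear form.  The sign is immaterial, as only c^2 = 2 + q + 1/q
    enters the relations between two reflections; the diagonal value is 2. *)
Definition coxeter_form s t : algC :=
  let q := dihedral_root (G s t) in sqrtC (2%:R + q + q^-1).
Local Notation c := coxeter_form.

Lemma coxeter_formC s t : c s t = c t s.
Proof. by rewrite /coxeter_form cox_sym. Qed.

Lemma coxeter_form_diag s : c s s = 2%:R.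
Proof.
rewrite /coxeter_form cox_diag.
have /eqP -> : dihedral_root (Some 1%N) == 1.
  by have /prim_expr_order := dihedral_root_prim (ltn0Sn 0); rewrite expr1 => ->.
have -> : 2%:R + 1 + 1^-1 = 2%:R ^+ 2 :> algC by rewrite invr1; ring.
by rewrite sqrCK // ler0n.
Qed.

(** The contragredient of the geometric representation: W acts on scalar functions
    on S, so that no basis is needed and S may be infinite. *)
Definition reflection s f : S -> algC := fun x => f x - c s x * f s.

Definition word_action u f : S -> algC := foldr reflection f u.

Lemma word_action_cat u v f :
  word_action (u ++ v) f = word_action u (word_action v f).
Proof. exact: foldr_cat. Qed.

Lemma reflectionK s : involutive (reflection s).
Proof.
by move=> f; apply/funext => x; rewrite /reflection coxeter_form_diag; ring.
Qed.

Lemma word_action_rev u f : word_action (rev u) (word_action u f) = f.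
Proof.
elim: u => //= s u IHu; rewrite rev_cons -cats1 word_action_cat /=.
by rewrite reflectionK.
Qed.

(** For m > 2, each value of (s t)^k f satisfies a recurrence with characteristic
    roots 1, q and 1/q; for m = 2, c = 0 and the two reflections commute. *)
Lemma word_action_dihedral s t m : s != t -> G s t = Some m ->
  forall f, word_action (dihedral_word m s t) f = f.
Proof.
move=> st Gst f; have m_ge2 := cox_ge2 st Gst.
have q_prim := dihedral_root_prim (ltnW m_ge2); set q := dihedral_root _ in q_prim.
have qm := prim_expr_order q_prim.
have q_neq0 : q != 0.
  move: qm; apply: contra_eq_neq => ->.
  by rewrite expr0n eqn0Ngt (ltnW m_ge2) eq_sym oner_eq0.
have c2 : c s t ^+ 2 = 2%:R + q + q^-1 by rewrite sqrtCK Gst.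
apply/funext => x.
have css := coxeter_form_diag s; have ctt := coxeter_form_diag t.
have cts := coxeter_formC t s.
case: (ltngtP m 2) => [|m_gt2|m2]; first by rewrite ltnNge m_ge2.
  pose g k := word_action (dihedral_word k s t) f x.
  apply: (@recurrence_periodic _ q q^-1 m g) => //.
  - exact: divff.
  - by rewrite -[q]expr1 -(prim_order_dvd q_prim) gtnNdvd // ltnW.
  - rewrite -(inj_eq (mulfI q_neq0)) divff // -expr2.
    by rewrite -(prim_order_dvd q_prim) gtnNdvd.
  move=> k; rewrite /g.
  have -> : 1 + q + q^-1 = c s t ^+ 2 - 1 by rewrite c2; ring.
  rewrite /dihedral_word /word_action /=; move: (foldr _ _ _) => h.
  by rewrite /reflection css ctt cts; ring.
have q1 : q = -1.
  have /eqP := qm; rewrite m2 sqrf_eq1 => /pred2P[q1|//].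
  by have := prim_order_dvd q_prim 1; rewrite q1 m2 expr1n eqxx.
have cst : c s t = 0 by rewrite /c Gst -/q q1 invrN1 addrK subrr sqrtC0.
by rewrite m2 /dihedral_word /= /reflection css ctt cts cst; ring.
Qed.

Lemma word_action_coxeter u v f :
  coxeter_class G u = coxeter_class G v -> word_action u f = word_action v f.
Proof.
move/coxeter_classP; apply: (congruent_invariant (F := word_action^~ f)).
move=> a b {}u {}v uv; rewrite !word_action_cat; congr (word_action a _).
move: (word_action b f) => {a b f} f; case: uv => [_ _ [s t m st Gst]|s].
  rewrite -[RHS](word_action_dihedral st Gst) -alternating_cat_rev.
  by rewrite word_action_cat word_action_rev.
by rewrite /= reflectionK.
Qed.

(** The product s t has order at least m_st in W.  An equality of alternating words
    of length k makes (s t)^k trivial, whereas s t multiplies some nonzero linear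
    form in the values at s and t by q; thus q^k = 1. *)
Lemma coxeter_class_alternating_inj s t k : s != t ->
    (forall m, G s t = Some m -> k < m)%N ->
    coxeter_class G (alternating k s t) = coxeter_class G (alternating k t s) ->
  k = 0%N.
Proof.
move=> st k_lt alt_eq; apply/eqP; rewrite -leqn0 leqNgt; apply/negP => k_gt0.
pose q := dihedral_root (G s t).
have q_neq0 : q != 0.
  rewrite /q; case Gst: (G s t) => [m|]; last by rewrite pnatr_eq0.
  have m_gt0 : (0 < m)%N by apply: ltnW (cox_ge2 st Gst).
  have := prim_expr_order (dihedral_root_prim m_gt0); apply: contra_eq_neq => ->.
  by rewrite expr0n eqn0Ngt m_gt0 eq_sym oner_eq0.
have [q' qq' c2] : exists2 q', q * q' = 1 & c s t ^+ 2 = 2%:R + q + q'.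
  by exists q^-1; [rewrite divff | rewrite sqrtCK].
have dih f : word_action (dihedral_word k s t) f = f.
  rewrite -alternating_cat_rev word_action_cat (word_action_coxeter _ alt_eq).
  by rewrite -{1}(revK (alternating k t s)) word_action_rev.
have css := coxeter_form_diag s; have ctt := coxeter_form_diag t.
have cts := coxeter_formC t s.
have eigenform (a b : algC) f :
    (forall h, a * reflection s (reflection t h) s +
      b * reflection s (reflection t h) t = q * (a * h s + b * h t)) ->
    a * f s + b * f t = q ^+ k * (a * f s + b * f t).
  move=> ab; rewrite -{1 2}(dih f).
  elim: (k) => [|j IHj]; first by rewrite mul1r.
  by rewrite exprS -mulrA -IHj -ab.
have qk : q ^+ k = 1.
  apply/eqP; have [q1|q1] := eqVneq q (-1).
    have cst : c s t = 0.
      have q'1 : q' = -1 by rewrite -[LHS]opprK -[- q']mulN1r -q1 qq' q1.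
      by apply/eqP; rewrite -sqrf_eq0 c2 q1 q'1; apply/eqP; ring.
    (* Here c = 0, and the value at s is already an eigenform. *)
    have := eigenform 1 0 (fun x => (x == s)%:R).
    rewrite !mul0r !addr0 !mul1r eqxx mulr1 => <- // h.
    by rewrite !mul0r !addr0 !mul1r /reflection css cts cst q1; ring.
  have := eigenform (c s t) (- (1 + q)) (fun x => (x == t)%:R).
  rewrite eqxx (negPf st) mulr0 add0r mulr1 => eig.
  have q1' : - (1 + q) != 0 by rewrite oppr_eq0 addrC addr_eq0.
  apply/eqP/(mulIf q1'); rewrite mul1r -eig // => h.
  by rewrite /reflection css ctt cts; ring: c2 qq'.
move: k_lt qk; rewrite /q; case Gst: (G s t) => [m|] k_lt qk.
  have := k_lt _ erefl; rewrite ltnNge dvdn_leq //.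
  have m_gt0 : (0 < m)%N by apply: ltnW (cox_ge2 st Gst).
  by rewrite (prim_order_dvd (dihedral_root_prim m_gt0)) qk.
have /eqP := qk; rewrite -natrX (eqr_nat _ _ 1) => /eqP.
by case: (k) k_gt0 => // j _; rewrite expnS => /(congr1 odd); rewrite oddM.
Qed.

End Representation.
End ReflectionRepresentation.

(** * Reduced words of the same element *)

Section Matsumoto.
Variables (S : choiceType) (G : coxeter_graph S).
Implicit Types (s t : S) (u v w : seq S).

Local Notation cls := (coxeter_class G).
Local Notation inversion := (@inversion S G).
Local Notation reduced := (reduced G).
Local Notation braid_eq := (congruent (braid_rel G)).

Lemma braid_class u v : braid_eq u v -> cls u = cls v.
Proof.
apply: (congruent_invariant (F := coxeter_class G)) => a b {}u {}v.
by move/braid_rel_class => uv; rewrite !coxeter_class_cat uv.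
Qed.

Lemma braid_size u v : braid_eq u v -> size u = size v.
Proof.
apply: congruent_invariant => a b _ _ [s t m _ _].
by rewrite !size_cat !size_alternating.
Qed.

Lemma braid_mem s u v : braid_eq u v -> (s \in u) = (s \in v).
Proof.
apply: (congruent_invariant (F := fun w => s \in w)) => a b _ _ [x y m xy Gxy].
by rewrite !mem_cat !mem_alternating ?(cox_ge2 xy Gxy) // (orbC (s == x)).
Qed.

Lemma braid_reduced u v : braid_eq u v -> reduced u -> reduced v.
Proof.
move=> uv red_u; apply: (reduced_class red_u); first exact/esym/braid_class.
exact/esym/braid_size.
Qed.

(** An element that s and t both shorten has a reduced word beginning with the
    alternating word of any length k <= m_st.  The induction exchanges s and t:
    prepending the missing letter to an alternating word deletes a letter, which
    cannot be in the alternating part, for this would equate two alternating words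
    shorter than m_st. *)
Lemma alternating_prefix u s t k : reduced u -> s != t ->
    inversion u (cls [:: s]) -> inversion u (cls [:: t]) ->
    (forall m, G s t = Some m -> k <= m)%N ->
  exists2 r, cls (alternating k s t ++ r) = cls u & (k + size r)%N = size u.
Proof.
move=> red_u st us ut; elim: k s t st us ut => [|k IHk] s t st us ut k_le.
  by exists u.
have [||||r rcls rsize] := IHk t s; rewrite 1?eq_sym //.
  by move=> m; rewrite cox_sym => /k_le/ltnW.
have : inversion (alternating k t s ++ r) (cls [:: s]).
  by rewrite (inversion_class rcls).
case/inversion_deletion => p [x [q [def_r spx]]].
have [kp|pk] := leqP k (size p).
  exists (drop k p ++ q).
    rewrite -rcls def_r -(deletion_class q spx) alternatingS cat_cons catA.
    congr (cls (s :: _ ++ q)); rewrite -[RHS](cat_take_drop k); congr (_ ++ _).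
    have := congr1 (take k) def_r.
    by rewrite take_size_cat ?size_alternating // takel_cat.
  rewrite -rsize; have := congr1 size def_r.
  rewrite !size_cat size_alternating /= size_drop => ->.
  by rewrite addnS addSn addnA subnKC.
have def_px : alternating (size p).+1 t s = rcons p x.
  have := congr1 (take (size p).+1) def_r.
  rewrite takel_cat ?size_alternating // take_alternating // => ->.
  by rewrite -cat_rcons take_size_cat // size_rcons.
have def_p : alternating (size p) t s = p.
  by rewrite -(take_alternating t s (leqnSn _)) def_px -cats1 take_size_cat.
suff : (size p).+1 = 0%N by [].
apply: (coxeter_class_alternating_inj st).
  by move=> m /k_le; apply: leq_trans.
by rewrite def_px -spx alternatingS def_p.
Qed.

(** By induction on the length.  Words with the same first letter are compared
    after removing it.  Words beginning with s and t are compared through two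
    words of the same element that begin with the two alternating words of length
    m_st: these differ by a braid move, and each shares its first letter with one
    of the given words. *)
Theorem matsumoto u v : reduced u -> reduced v -> cls u = cls v -> braid_eq u v.
Proof.
move=> red_u red_v uv; have suv : size u = size v.
  by apply/eqP; rewrite eqn_leq red_u ?red_v.
move: {2}(size u) (leqnn (size u)) => N; move: red_u red_v uv suv.
elim: N u v => [|N IHN] [|s u] [|t v] //; try by move=> *; apply: rst_refl.
move=> red_su red_tv uv [suv] leN.
have same_head x w w' : (size w <= N)%N -> reduced (x :: w) ->
    cls (x :: w) = cls (x :: w') -> size w = size w' -> braid_eq (x :: w) (x :: w').
  move=> wN red_w ww' sww'; apply: (@congruent_cat _ _ [:: x] [:: x]).
    exact: rst_refl.
  have red_w' : reduced (x :: w') by apply: (reduced_class red_w); rewrite //= sww'.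
  apply: IHN => //; first exact: reduced_catr [:: x] w red_w.
    exact: reduced_catr [:: x] w' red_w'.
  apply: (mulgI (cls [:: x])).
  by rewrite -!(coxeter_class_cat G [:: x]).
have [st|st] := eqVneq s t; first by rewrite -st in red_tv uv *; apply: same_head.
have us := inversion_reduced_head red_su.
have ut : inversion (s :: u) (cls [:: t]).
  by rewrite (inversion_class uv); apply: inversion_reduced_head.
case Gst: (G s t) => [m|]; last first.
  (* With no relation between s and t, the alternating prefix could be longer
     than the word itself. *)
  have [|r _] := alternating_prefix (k := (size u).+2) red_su st us ut.
    by rewrite Gst.
  by move=> sz; have := leq_addr (size r) (size u).+2; rewrite sz ltnn.
have [|r rcls] := alternating_prefix (k := m) red_su st us ut.
  by rewrite Gst => _ [<-].
have := cox_ge2 st Gst.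
case: m Gst rcls => // m Gst rcls _; rewrite addSn => -[rsize].
have braid : braid_eq (alternating m.+1 s t ++ r) (alternating m.+1 t s ++ r).
  by apply: rst_step; apply: (RewriteStep [::] r (BraidRel st Gst)).
apply: (@rst_trans _ _ _ (alternating m.+1 s t ++ r)).
  rewrite alternatingS cat_cons in rcls *; apply: same_head => //.
  by rewrite size_cat size_alternating.
apply: (rst_trans _ _ _ _ _ braid); have := braid_class braid; rewrite rcls uv.
rewrite alternatingS cat_cons => tv.
apply/rst_sym/same_head => //; first by rewrite -suv.
by rewrite size_cat size_alternating rsize -suv.
Qed.

End Matsumoto.

(** * Garside elements *)

Section Garside.
Variables (S : choiceType) (G : coxeter_graph S).
Implicit Types (s t : S) (u v w : seq S).

Local Notation cls := (coxeter_class G).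
Local Notation inversion := (@inversion S G).
Local Notation reduced := (reduced G).

Definition artin_class u : artin_monoid G := pres_class (braid_rel G) u.

Lemma artin_classP u v :
  artin_class u = artin_class v <-> congruent (braid_rel G) u v.
Proof. exact: pres_classP. Qed.

Lemma artin_class_repr (x : artin_monoid G) : artin_class (repr x) = x.
Proof. exact: pres_classK. Qed.

Lemma artin_class_cat u v : artin_class (u ++ v) = artin_class u * artin_class v.
Proof. exact: pres_class_cat. Qed.

Lemma artin_class1 s : artin_class [:: s] = artin_gen G s.
Proof. by []. Qed.

Lemma artin_class_reduced u v : reduced u -> cls u = cls v -> size u = size v ->
  artin_class u = artin_class v.
Proof.
move=> red_u uv suv; apply/artin_classP/matsumoto => //.
exact: reduced_class red_u _ _.
Qed.

Lemma bounded_reduced :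
  spherical G -> exists N, forall u, reduced u -> (size u <= N)%N.
Proof.
case/finite_seqP=> ws def_ws; exists (\max_(w <- ws) size (repr w)) => u red_u.
have : [set: coxeter_group G] (cls u) by [].
rewrite def_ws /= => u_ws.
apply: leq_trans (red_u (repr (cls u)) (coxeter_class_repr _)) _.
exact: (leq_bigmax_seq (F := fun w : coxeter_group G => size (repr w))).
Qed.

Lemma exists_longest : spherical G ->
  exists2 d, reduced d & forall u, reduced u -> (size u <= size d)%N.
Proof.
case/bounded_reduced=> N leN.
pose P k := `[< exists2 u, reduced u & size u = k >].
have exP : exists k, P k by exists 0%N; apply/asboolP; exists [::].
have P_le k : P k -> (k <= N)%N by case/asboolP=> u /leN ? <-.
case: (ex_maxnP exP P_le) => k /asboolP[d red_d <-] kmax.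
by exists d => // u red_u; apply/kmax/asboolP; exists u.
Qed.

(** A longest reduced word cannot be prolonged, so by exchange its class in the
    Artin monoid is a common multiple of the generators; D is a prefix of it. *)
Lemma garside_reduced D d : spherical G -> is_garside D -> artin_class d = D ->
  reduced d.
Proof.
move=> sphG [_ minD] def_D; have [w red_w wmax] := exists_longest sphG.
have : ldivides D (artin_class w).
  apply: minD => s.
  have : inversion w (cls [:: s]).
    apply: inversion_not_reduced => // /wmax.
    by rewrite ltnn.
  case/(reduced_exchange red_w)=> v red_sv [sv_w size_sv].
  exists (artin_class v); rewrite -(artin_class_cat [:: s]).
  exact/esym/artin_class_reduced.
case=> r; rewrite -def_D -(artin_class_repr r) -artin_class_cat => /artin_classP.
by move/braid_reduced => /(_ red_w); apply: reduced_catl.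
Qed.

Lemma garside_inversion D d s : spherical G -> is_garside D -> artin_class d = D ->
  inversion d (cls [:: s]).
Proof.
move=> sphG garD def_D; case: (garD) => divD _; have [r] := divD s.
rewrite -def_D -(artin_class_repr r) -(artin_class_cat [:: s]) => /artin_classP dsr.
rewrite (inversion_class (braid_class dsr)); apply: inversion_reduced_head.
by apply: braid_reduced dsr _; apply: garside_reduced def_D.
Qed.

(** If u r = d, prepending s to u r deletes a letter by exchange.  When s u is
    reduced that letter lies in r, so that d also has s u as a prefix. *)
Lemma reduced_prefix_of_longest d u : reduced d ->
    (forall s, inversion d (cls [:: s])) -> reduced u ->
  exists2 r, cls (u ++ r) = cls d & (size u + size r)%N = size d.
Proof.
move=> red_d inv_d; elim: u => [|s u IHu] red_su; first by exists d.
have [r ur_d sz] := IHu (reduced_catr (u := [:: s]) red_su).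
have : inversion (u ++ r) (cls [:: s]) by rewrite (inversion_class ur_d).
case/inversion_deletion=> p [x [q [def_ur spx]]].
have [up|pu] := leqP (size u) (size p).
  have def_u : take (size u) p = u.
    have := congr1 (take (size u)) def_ur.
    by rewrite take_size_cat // takel_cat.
  exists (drop (size u) p ++ q).
    rewrite cat_cons catA -{1}def_u cat_take_drop (deletion_class q spx).
    by rewrite -def_ur.
  rewrite -sz; have := congr1 size def_ur; rewrite !size_cat /= size_drop => ->.
  by rewrite addnS addSn addnA subnKC.
(* A letter deleted from u would give s u a shorter word. *)
pose q' := drop (size p).+1 u.
have def_u : u = p ++ x :: q'.
  have := congr1 (take (size p).+1) def_ur.
  rewrite takel_cat // -cat_rcons take_size_cat ?size_rcons // => tk.
  by rewrite -cat_rcons -tk cat_take_drop.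
have := red_su (p ++ q'); rewrite (coxeter_class_cons G s u) def_u.
rewrite -(deletion_class q' spx) (coxeter_class_cons G s (p ++ q')) coxeter_genK.
by move/(_ erefl); rewrite /= !size_cat /= addnS ltnNge leqnSn.
Qed.

(** Write D = s e.  The reduced word e is a prefix of D that is one letter short,
    so D = e t, and s D = s e t = D t. *)
Lemma garside_conj D s : spherical G -> is_garside D ->
  exists t, artin_gen G s * D = D * artin_gen G t /\ rdivides (artin_gen G t) D.
Proof.
move=> sphG garD; have def_D := artin_class_repr D; set d := repr D in def_D.
have red_d := garside_reduced sphG garD def_D.
have inv_d x := garside_inversion x sphG garD def_D.
have [e red_se [se_d size_se]] := reduced_exchange red_d (inv_d s).
have red_e := reduced_catr (u := [:: s]) red_se.
have [r er_d sz] := reduced_prefix_of_longest red_d inv_d red_e.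
have : size r = 1%N by apply: (@addnI (size e)); rewrite sz -size_se addn1.
case: r er_d sz => [|t [|? ?]] // et_d sz _.
exists t.
have def_D1 : D = artin_gen G s * artin_class e.
  by rewrite -(artin_class_cat [:: s]) -def_D; apply: artin_class_reduced.
have def_D2 : D = artin_class e * artin_gen G t.
  rewrite -(artin_class_cat _ [:: t]) -def_D; apply: artin_class_reduced => //.
  by rewrite size_cat.
split; last by exists (artin_class e).
by rewrite {1}def_D2 mulgA -def_D1.
Qed.

Lemma garside_no_square D s l r : spherical G -> is_garside D ->
  l * artin_gen G s * artin_gen G s * r <> D.
Proof.
move=> sphG garD; rewrite -(artin_class_repr l) -(artin_class_repr r).
rewrite -artin_class1 -!artin_class_cat.
move/(garside_reduced sphG garD); rewrite -2!catA.
exact: not_reduced_square.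
Qed.

Lemma coxeter_gen_inj s t : cls [:: s] = cls [:: t] -> s = t.
Proof.
move=> st; apply/eqP/negPn/negP => neq_st.
suff : 1%N = 0%N by [].
apply: (coxeter_class_alternating_inj (k := 1) neq_st _ st) => m.
exact: cox_ge2.
Qed.

(** This instance of right cancellation already holds in W. *)
Lemma artin_mulIgen s t D : artin_gen G s * D = artin_gen G t * D -> s = t.
Proof.
rewrite -(artin_class_repr D) -(artin_class_cat [:: s]) -(artin_class_cat [:: t]).
move/artin_classP/braid_class; rewrite !(coxeter_class_cat G [:: _] (repr D)).
by move/mulIg/coxeter_gen_inj.
Qed.

End Garside.

(** Conjugation by D is injective on the finite set of generators, hence onto; so
    every generator divides D on the right too. *)
Lemma garside_conj_bij n (G : coxeter_graph 'I_n) D : spherical G -> is_garside D ->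
  exists2 tau : 'I_n -> 'I_n, bijective tau & forall i,
    artin_gen G (tau i) * D = D * artin_gen G i /\ rdivides (artin_gen G i) D.
Proof.
move=> sphG garD; have [tau tauP] := choice (fun i => garside_conj i sphG garD).
have tau_inj : injective tau.
  move=> i j ij; apply: (@artin_mulIgen _ G _ _ D).
  by have [-> _] := tauP i; have [-> _] := tauP j; rewrite ij.
have [tau' tauK tau'K] := injF_bij tau_inj.
exists tau'; first by exists tau.
by move=> i; have := tauP (tau' i); rewrite tau'K.
Qed.

(** * The relative Garside element *)

Section RelativeGarside.
Variables (n : nat) (G' : coxeter_graph 'I_n) (G : coxeter_graph 'I_n.+1).
Hypotheses (sub : full_subgraph G' G) (sphG : spherical G).
Variables (D' : artin_monoid G') (D R : artin_monoid G).
Hypotheses (garD : is_garside D) (relR : D = artin_incl G D' * R).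

Local Notation x := (artin_gen G).
Local Notation inc := (lift ord_max).

Lemma artin_class_incl w :
  artin_incl G (artin_class G' w) = artin_class G (map inc w).
Proof. exact: (pres_mapE (braid_rel_lift sub)). Qed.

Lemma artin_inclM : {morph artin_incl G (G' := G') : y z / y * z}.
Proof. by case: (artin_incl_morphism sub). Qed.

(** Braid moves preserve the set of letters, and the new generator occurs in D but
    not in D'. *)
Lemma relative_garside_neq1 : R <> 1.
Proof.
move=> R1; have [r] := garD.1 ord_max.
rewrite relR R1 mulg1 -(artin_class_repr D') artin_class_incl -(artin_class_repr r).
rewrite -(artin_class_cat _ [:: _]) => /artin_classP/(braid_mem ord_max).
rewrite mem_head => /mapP[i _ /eqP]; apply/negP.
exact: neq_lift.
Qed.

(** With D' = e x_i and R = x_i r, the square of x_i would divide D. *)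
Lemma not_ldivides_relative_garside i :
  rdivides (artin_gen G' i) D' -> ~ ldivides (x (inc i)) R.
Proof.
case=> e def_D' [r def_R].
apply: (@garside_no_square _ _ D (inc i) (artin_incl G e) r sphG garD).
by rewrite relR def_D' artin_inclM (artin_incl_gen sub) def_R !mulgA.
Qed.

(** The equation D' x_i R = D' R x_j holds by the hypotheses.  Its factor D' cancels
    in W, and x_i R is reduced as a suffix of D. *)
Lemma relative_garside_conj i k j :
    rdivides (artin_gen G' i) D' -> artin_gen G' k * D' = D' * artin_gen G' i ->
    x (inc k) * D = D * x j ->
  x (inc i) * R = R * x j.
Proof.
case=> e def_D' kD' kD; set rho := repr R.
have def_R : artin_class G rho = R by apply: artin_class_repr.
rewrite -def_R -!artin_class1 -!artin_class_cat.
have red : reduced G ([:: inc i] ++ rho).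
  apply: (reduced_catr (u := repr (artin_incl G e))).
  apply: (garside_reduced sphG garD).
  rewrite !artin_class_cat artin_class_repr def_R.
  by rewrite relR def_D' artin_inclM (artin_incl_gen sub) mulgA.
apply: artin_class_reduced => //; last by rewrite !size_cat addnC.
apply: (mulgI (coxeter_class G (repr (artin_incl G D')))).
rewrite -!(coxeter_class_cat G (repr _)); apply/braid_class/artin_classP.
rewrite !artin_class_cat artin_class_repr def_R !artin_class1.
by rewrite !mulgA -relR -kD relR -!(artin_incl_gen sub) !mulgA -!artin_inclM kD'.
Qed.

End RelativeGarside.

Theorem proposition1 (n : nat) (hn : (2 <= n.+1)%N)
    (G' : coxeter_graph 'I_n) (G : coxeter_graph 'I_n.+1)
    (sub : full_subgraph G' G) (sphG' : spherical G') (sphG : spherical G)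
    (D' : artin_monoid G') (D : artin_monoid G)
    (garD' : is_garside D') (garD : is_garside D)
    (R : artin_monoid G) (relR : D = artin_incl G D' * R)
    (sigma_n : {perm 'I_n.+1})
    (conjD : forall i, artin_gen G i * D = D * artin_gen G (sigma_n i)) :
  [/\ square_free R,
      forall i : 'I_n.+1, ldivides (artin_gen G i) R <-> i = ord_max,
      exists2 sigma : 'I_n -> 'I_n.+1,
        set_bij [set: 'I_n] [set~ sigma_n ord_max] sigma &
        forall i : 'I_n,
          artin_gen G (lift ord_max i) * R = R * artin_gen G (sigma i) &
      forall j : 'I_n.+1, rdivides (artin_gen G j) R <-> j = sigma_n ord_max].
Proof.
have [tau [tau' tauK tau'K] tauP] := garside_conj_bij sphG' garD'.
have R_neq1 := relative_garside_neq1 sub garD relR.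
pose sigma i := sigma_n (lift ord_max (tau i)).
have sigmaP i : artin_gen G (lift ord_max i) * R = R * artin_gen G (sigma i).
  have [kD' divD'] := tauP i.
  exact: (relative_garside_conj sub sphG garD relR divD' kD' (conjD _)).
have sigma_onto j : j != sigma_n ord_max -> exists i, j = sigma i.
  move=> j_neq; case: (unliftP ord_max (sigma_n^-1 j)%g) => [k def_k|def_max].
    by exists (tau' k); rewrite /sigma tau'K -def_k permKV.
  by rewrite -def_max permKV eqxx in j_neq.
have ldivR i : ldivides (artin_gen G i) R -> i = ord_max.
  case: (unliftP ord_max i) => [k ->|//] div_k; have [_ divD'] := tauP k.
  by case: (not_ldivides_relative_garside sub sphG garD relR divD' div_k).
have rdivR j : rdivides (artin_gen G j) R -> j = sigma_n ord_max.
  case=> r def_R; apply/eqP/negPn/negP => /sigma_onto[i def_j].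
  have [_ [e def_D']] := tauP i.
  apply: (@garside_no_square _ _ D j (artin_incl G e * r) 1 sphG garD).
  rewrite mulg1 -(mulgA _ r) -def_R -mulgA def_j -sigmaP mulgA relR def_D'.
  by rewrite (artin_inclM sub) (artin_incl_gen sub).
split.
- case=> s [l [r def_R]].
  apply: (@garside_no_square _ _ D s (artin_incl G D' * l) r sphG garD).
  by rewrite relR def_R expg2 !mulgA.
- move=> i; split=> [/ldivR //|->].
  case def_rho: (repr R) => [|s rho].
    by case: R_neq1; rewrite -(artin_class_repr R) def_rho.
  have div_s : ldivides (artin_gen G s) R.
    exists (artin_class G rho).
    by rewrite -(artin_class_repr R) def_rho -(artin_class_cat _ [:: s]).
  by rewrite -(ldivR _ div_s).
- exists sigma => //; split.
  + by move=> i _ /=; apply/eqP; rewrite (inj_eq perm_inj) eq_sym neq_lift.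
  + by move=> i j _ _ /perm_inj/lift_inj/(can_inj tauK).
  + by move=> j /eqP/sigma_onto[i ->]; exists i.
- move=> j; split=> [/rdivR //|->].
  case/lastP def_rho: (repr R) => [|rho s].
    by case: R_neq1; rewrite -(artin_class_repr R) def_rho.
  have div_s : rdivides (artin_gen G s) R.
    exists (artin_class G rho).
    by rewrite -(artin_class_repr R) def_rho -cats1 artin_class_cat.
  by rewrite -(rdivR _ div_s).
Qed.
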